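(* Let $n > 2$ be an integer and $q = 2^n$. Let $L_{B_n}$ be the set of leaves of $G_q$ contained in $B_n$, and let $$T_{q+1} := \{\alpha \in \mathbb{F}_q^* : D_{q+1}(\alpha) = 0,\ D_{q+1}(\alpha^{-1}) \neq 0\}.$$ Then $L_{B_n}$ is not empty and $T_{q+1} = L_{B_n}$.
   Context: $D_m(x) = \sum_{i=0}^{\lfloor m/2 \rfloor} \frac{m}{m-i}\binom{m-i}{i}(-1)^i x^{m-2i} \in \mathbb{F}_q[x]$ is the Dickson polynomial of the first kind of degree $m>0$ with parameter $1$ (the integer coefficients being reduced mod $2$); it satisfies $D_m(x+x^{-1}) = x^m + x^{-m}$. The map $\theta$ on $\mathbf{P}^1(\mathbb{F}_q) = \mathbb{F}_q \cup \{\infty\}$ is defined by $\theta(0) = \theta(\infty) = \infty$ and $\theta(x) = x + x^{-1}$ otherwise. $G_q$ is the directed graph with vertex set $\mathbf{P}^1(\mathbb{F}_q)$ and an arrow from $\alpha$ to $\theta(\alpha)$ for each vertex $\alpha$. A leaf of $G_q$ is a vertex with no incoming arrow, i.e. not of the form $\theta(x)$ with $x \in \mathbf{P}^1(\mathbb{F}_q)$. $\mathrm{Tr}_n(x) = \sum_{j=0}^{n-1} x^{2^j}$ is the absolute trace on $\mathbb{F}_{2^n}$, and $B_n := \{\alpha \in \mathbb{F}_q^* : \mathrm{Tr}_n(\alpha) \neq \mathrm{Tr}_n(\alpha^{-1})\}$. *)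

(* Defs.v *)
From HB Require Import structures.
From mathcomp Require Import all_boot all_order all_algebra.

Set Implicit Arguments.
Unset Strict Implicit.
Unset Printing Implicit Defensive.

Import GRing.Theory.
Local Open Scope ring_scope.

Definition dickson_coef (m i : nat) : nat :=
  ((m * 'C(m - i, i)) %/ (m - i))%N.

(* The division in [dickson_coef] is exact, so that it is m / (m - i) times
   the binomial coefficient. *)
Lemma dickson_coefE (m i : nat) :
  (0 < m)%N -> (i <= m./2)%N -> (dickson_coef m i * (m - i) = m * 'C(m - i, i))%N.
Proof.
move=> m0 im; rewrite /dickson_coef divnK //.
have im' : (i <= m)%N by rewrite (leq_trans im) // -divn2 leq_div.
have -> : (m * 'C(m - i, i) = (m - i) * 'C(m - i, i) + i * 'C(m - i, i))%N.
  by rewrite -mulnDl subnK.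
rewrite dvdn_addr; last exact: dvdn_mulr.
case: i im im' => [|i] im im'; first by rewrite mul0n dvdn0.
have mi : (0 < m - i.+1)%N.
  by rewrite subn_gt0 (leq_ltn_trans im) // -divn2 ltn_Pdiv.
by rewrite -(prednK mi) -mul_bin_diag dvdn_mulr.
Qed.

(* Dickson polynomial of the first kind of degree m > 0 with parameter 1. *)
Definition dickson (R : nzRingType) (m : nat) : {poly R} :=
  \sum_(i < m./2.+1) ((dickson_coef m i)%:R * (-1) ^+ i) *: 'X^(m - i.*2).

Section Graph.

Variable F : finFieldType.

(* P^1(F) is [option F], where [None] is the point at infinity. *)
Definition P1 : finType := option F.

Definition theta (a : P1) : P1 :=
  match a with
  | None => None
  | Some x => if x == 0 then None else Some (x + x^-1)
  end.

(* There is an arrow from a to b exactly when theta a = b. *)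
Definition Gq : rel P1 := frel theta.

Definition leaves : {set P1} := [set b | [forall a, ~~ Gq a b]].

Definition Tr (n : nat) (x : F) : F := \sum_(j < n) x ^+ (2 ^ j).

Definition B (n : nat) : {set F} :=
  [set a : F | (a != 0) && (Tr n a != Tr n a^-1)].

Definition L_B (n : nat) : {set F} :=
  [set a in B n | (Some a : P1) \in leaves].

Definition T (m : nat) : {set F} :=
  [set a : F | [&& a != 0, (dickson F m).[a] == 0 & (dickson F m).[a^-1] != 0]].

End Graph.

(* Main.v *)
Require Import Defs.
From mathcomp Require Import all_boot all_order all_algebra all_field.
From mathcomp Require Import zify ring.

(** In characteristic 2 the recurrence of the Dickson polynomials yields
    D_(2k+1) = D_k D_(k+1) + x and D_(2^k) = x^(2^k), hence
    D_(q+1)(a) = a^2 (1 + Tr(1/a)) for a in F_q^*, without leaving F_q.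
    On the other hand x + 1/x = a becomes z^2 + z = 1/a^2 with x = a z, which is
    solvable if and only if Tr(1/a) = 0. So D_(q+1)(a) = 0 if and only if a is a
    leaf, if and only if Tr(1/a) = 1, and both sets of the theorem consist of
    the a with Tr(1/a) = 1 and Tr(a) = 0. *)

Set Implicit Arguments.
Unset Strict Implicit.
Unset Printing Implicit Defensive.

Import GRing.Theory.

Section DicksonTrace.

Local Open Scope ring_scope.

(** * Three-term recurrence over a commutative ring *)

Section DicksonRecurrence.

Lemma dickson_coef0 (m : nat) : dickson_coef m.+1 0 = 1%N.
Proof. by rewrite /dickson_coef subn0 bin0 muln1 divnn. Qed.

Lemma dickson_coef_gt_half (m i : nat) : (m < i.*2)%N -> dickson_coef m i = 0%N.
Proof. by move=> lt; rewrite /dickson_coef bin_small ?muln0 ?div0n //; lia. Qed.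

(** Trades the division for a sum of two binomial coefficients, to which Pascal's rule applies. *)
Lemma dickson_coefSE (k i : nat) :
  dickson_coef (k.+1 + i.+1) i.+1 = ('C(k.+1, i.+1) + 'C(k, i))%N.
Proof.
by rewrite /dickson_coef addnK mulnDl -mul_bin_diag -mulnDr mulKn.
Qed.

Lemma dickson_coef_rec (m i : nat) :
  dickson_coef m.+3 i.+1 = (dickson_coef m.+2 i.+1 + dickson_coef m.+1 i)%N.
Proof.
have [lt|le] := ltnP m.+3 i.+1.*2.
  by rewrite !dickson_coef_gt_half //; lia.
have [k em] : exists k, m.+3 = (k.+2 + i.+1)%N by exists (m - i)%N; lia.
have em' : m.+2 = (k.+1 + i.+1)%N by lia.
rewrite em em' !dickson_coefSE.
case: i em {em' le} => [|i] em.
  by rewrite dickson_coef0 !bin0 !bin1; lia.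
have -> : m.+1 = (k.+1 + i.+1)%N by lia.
by rewrite dickson_coefSE !binS; lia.
Qed.

Variable R : comNzRingType.

(** Lets the sums in the recurrence share a range: the added terms, whose exponents are truncated,
    have coefficient 0. *)
Lemma dickson_widen (m N : nat) : (m./2 < N)%N ->
  dickson R m =
    \sum_(i < N) ((dickson_coef m i)%:R * (-1) ^+ i) *: 'X^(m - i.*2).
Proof.
move=> leN; rewrite /dickson.
pose f i : {poly R} := ((dickson_coef m i)%:R * (-1) ^+ i) *: 'X^(m - i.*2).
rewrite (big_ord_widen_cond N predT f) // {}/f.
rewrite big_mkcond; apply: eq_bigr => i _ /=; case: ltnP => // le.
by rewrite dickson_coef_gt_half ?mul0r ?scale0r //; lia.
Qed.

Lemma dickson_rec (m : nat) :
  dickson R m.+3 = 'X * dickson R m.+2 - dickson R m.+1.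
Proof.
rewrite (@dickson_widen m.+3 m.+3) ?(@dickson_widen m.+2 m.+3); try lia.
rewrite (@dickson_widen m.+1 m.+2); last lia.
rewrite big_ord_recl [in RHS]big_ord_recl mulrDr -addrA.
congr (_ + _).
  by rewrite !dickson_coef0 !expr0 !mulr1 !scale1r !subn0 -exprS.
rewrite mulr_sumr -sumrB; apply: eq_bigr => i _.
rewrite !lift0 dickson_coef_rec natrD mulrDl scalerDl.
congr (_ + _).
  have [lt|le] := ltnP m.+2 i.+1.*2.
    by rewrite dickson_coef_gt_half // mul0r !scale0r mulr0.
  by rewrite -scalerAr -exprS; congr (_ *: 'X^_); lia.
by rewrite exprS mulN1r mulrN scaleNr doubleS.
Qed.

End DicksonRecurrence.

(** * Doubling formulas in characteristic 2 *)

Section CharacteristicTwo.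

Variables (R : comNzRingType) (charR2 : 2 \in [pchar R]).

(* At m = 0 the junk value dickson R 0 = 0 agrees with D_0 = 2 = 0. *)
Lemma dickson_horner_rec2 (a : R) (m : nat) :
  (dickson R m.+2).[a] = a * (dickson R m.+1).[a] + (dickson R m).[a].
Proof.
case: m => [|m]; last by rewrite dickson_rec !hornerE oppr_pchar2.
rewrite /dickson !big_ord_recr !big_ord0 /= /dickson_coef /= !hornerE.
by rewrite (_ : 2%:R = 0) ?(pcharf0 charR2) ?mul0r //= ?hornerE.
Qed.

Let two0 : 2%:R = 0 :> R. Proof. exact: pcharf0. Qed.

Lemma dickson_horner0 (a : R) : (dickson R 0).[a] = 0.
Proof. by rewrite /dickson big_ord1 /dickson_coef mul0r scale0r horner0. Qed.

Lemma dickson_horner1 (a : R) : (dickson R 1).[a] = a.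
Proof. by rewrite /dickson big_ord1 dickson_coef0 mulr1 scale1r hornerX. Qed.

(** In characteristic 2 the form u^2 + a u v + v^2 is invariant under (u, v) -> (a u + v, u), and it
    is a^2 at the starting pair (a, 0). *)
Lemma dickson_horner_norm (a : R) (m : nat) :
  (dickson R m.+1).[a] ^+ 2 =
    a * (dickson R m).[a] * (dickson R m.+1).[a]
    + (dickson R m).[a] ^+ 2 + a ^+ 2.
Proof.
elim: m => [|m IH]; first by rewrite dickson_horner0 dickson_horner1; ring.
rewrite dickson_horner_rec2.
set u := (dickson R m.+1).[a] in IH *; set v := (dickson R m).[a] in IH *.
by rewrite [u ^+ 2]IH; ring: two0 IH.
Qed.

Lemma dickson_horner_double (a : R) (m : nat) :
  (dickson R m.*2).[a] = (dickson R m).[a] ^+ 2 /\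
  (dickson R m.*2.+1).[a] = (dickson R m).[a] * (dickson R m.+1).[a] + a.
Proof.
elim: m => [|m [IHe IHo]].
  by rewrite !dickson_horner0 dickson_horner1; split; ring.
have even_step : (dickson R m.+1.*2).[a] = (dickson R m.+1).[a] ^+ 2.
  by rewrite doubleS dickson_horner_rec2 IHe IHo dickson_horner_norm; ring.
split=> //; rewrite doubleS dickson_horner_rec2 -doubleS even_step IHo.
by rewrite [in RHS]dickson_horner_rec2; ring.
Qed.

Lemma dickson_horner_pow2 (a : R) (k : nat) :
  (dickson R (2 ^ k)).[a] = a ^+ (2 ^ k).
Proof.
elim: k => [|k IH]; first by rewrite dickson_horner1.
by rewrite expnSr muln2 (dickson_horner_double a _).1 IH -exprM muln2.
Qed.

End CharacteristicTwo.

(** With c_k = D_(2^k+1)(a) / a^(2^k+1), odd doubling reads c_(k+1) = c_k + a^(-2^(k+1)), and c_0 =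
    1. *)
Lemma dickson_horner_pow2S (K : fieldType) (charK2 : 2 \in [pchar K])
    (a : K) (k : nat) :
  a != 0 ->
  (dickson K (2 ^ k).+1).[a] =
    a ^+ (2 ^ k).+1 * (1 + \sum_(j < k) a^-1 ^+ (2 ^ j.+1)).
Proof.
move=> a0; elim: k => [|k IH].
  rewrite big_ord0 addr0 mulr1 dickson_horner_rec2 //.
  by rewrite dickson_horner0 dickson_horner1 addr0.
rewrite expnSr muln2 (dickson_horner_double charK2 a _).2 IH.
rewrite dickson_horner_pow2 // big_ord_recr /= addrA [in RHS]mulrDr.
congr (_ + _); first by rewrite mulrA -exprD addnS addnn.
by rewrite expnSr muln2 exprVn exprS mulfK // expf_neq0.
Qed.

(** * The absolute trace and Artin-Schreier equations *)

Section Trace.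

Variables (F : finFieldType) (n : nat) (hF : #|F| = (2 ^ n)%N).

Let charF2 : 2 \in [pchar F]. Proof. exact: card_finPcharP hF _. Qed.

Let expf_q (x : F) : x ^+ (2 ^ n) = x. Proof. by rewrite -hF expf_card. Qed.

Lemma TrD (x y : F) : Tr n (x + y) = Tr n x + Tr n y.
Proof.
rewrite /Tr -big_split; apply: eq_bigr => j _.
by rewrite exprDn_pchar // pnatX pnatE // charF2.
Qed.

Lemma Tr_shift (x : F) : \sum_(j < n) x ^+ (2 ^ j.+1) = Tr n x.
Proof.
have : \sum_(j < n.+1) x ^+ (2 ^ j) = Tr n x + x.
  by rewrite big_ord_recr /= expf_q.
by rewrite big_ord_recl /= addrC => /addIr.
Qed.

Lemma Tr_sqr (x : F) : Tr n (x ^+ 2) = Tr n x.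
Proof.
by rewrite -[RHS]Tr_shift; apply: eq_bigr => j _; rewrite -exprM expnS.
Qed.

Lemma Tr_idem (x : F) : Tr n x ^+ 2 = Tr n x.
Proof.
rewrite -[RHS]Tr_shift -(pFrobenius_autE charF2) rmorph_sum.
by apply: eq_bigr => j _; rewrite /= pFrobenius_autE -exprM expnSr.
Qed.

(** By [Tr_idem] the trace is a root of t (t - 1). *)
Lemma Tr_eq1 (x : F) : (Tr n x == 1) = (Tr n x != 0).
Proof.
have := Tr_idem x; move/eqP; rewrite -subr_eq0 expr2 -{3}[Tr n x]mulr1 -mulrBr.
rewrite mulf_eq0 subr_eq0; case: eqP => //= -> _.
by rewrite eq_sym oner_eq0.
Qed.

Lemma dickson_horner_card_succ (a : F) : a != 0 ->
  (dickson F (2 ^ n).+1).[a] = a ^+ 2 * (1 + Tr n a^-1).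
Proof. by move=> a0; rewrite dickson_horner_pow2S // exprS expf_q Tr_shift. Qed.

Lemma dickson_root_card_succ (a : F) : a != 0 ->
  ((dickson F (2 ^ n).+1).[a] == 0) = (Tr n a^-1 != 0).
Proof.
move=> a0; rewrite dickson_horner_card_succ // mulf_eq0 expf_eq0 /= (negPf a0) /=.
by rewrite -Tr_eq1 addrC -{1}(oppr_pchar2 charF2 1) subr_eq0.
Qed.

Lemma Tr_artin_schreier (z : F) : Tr n (z ^+ 2 + z) = 0.
Proof. by rewrite TrD Tr_sqr addrr_pchar2. Qed.

Hypothesis n_gt0 : (0 < n)%N.

Lemma card_Tr_ker_le : (#|[set x : F | Tr n x == 0%R]| <= 2 ^ n.-1)%N.
Proof.
pose P : {poly F} := \sum_(j < n) 'X^(2 ^ j).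
have P_neq0 : P != 0.
  (* Only the summand j = 0 contributes to the coefficient of X. *)
  apply/eqP => /(congr1 (fun p : {poly F} => p`_1)); rewrite coef0 coef_sum.
  rewrite (bigD1 (Ordinal n_gt0)) //= coefXn eqxx big1 ?addr0; last first.
    move=> j j0; rewrite coefXn; case: eqP => // e.
    case/eqP: j0; apply: ord_inj => /=.
    by have := expn_eq0 2 j; case: (j : nat) e => // k; rewrite expnS; lia.
  by move/eqP; rewrite oner_eq0.
have size_P : (size P <= (2 ^ n.-1).+1)%N.
  apply: leq_trans (size_sum _ _ _) _; apply/bigmax_leqP => j _.
  by rewrite size_polyXn ltnS leq_pexp2l // -ltnS prednK.
rewrite cardE -ltnS; apply: leq_trans size_P.
apply: max_poly_roots => //; last exact: enum_uniq.
apply/allP => x; rewrite mem_enum inE => /eqP Tr0.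
rewrite rootE horner_sum -[X in _ == X]Tr0.
by apply/eqP/eq_bigr => j _; rewrite hornerXn.
Qed.

Lemma artin_schreier_fiber (z w : F) :
  w ^+ 2 + w = z ^+ 2 + z -> w = z \/ w = z + 1.
Proof.
move=> e; have : (w - z) * (w - (z + 1)) == 0.
  rewrite !(oppr_pchar2 charF2); apply/eqP.
  have two0 : 2%:R = 0 :> F by exact: pcharf0.
  transitivity ((w ^+ 2 + w) + (z ^+ 2 + z)); first by ring: two0.
  by rewrite e addrr_pchar2.
by rewrite mulf_eq0 !subr_eq0 => /orP[]/eqP; [left|right].
Qed.

(** The fibers of z -> z^2 + z have at most two elements. *)
Lemma card_artin_schreier_ge :
  (2 ^ n.-1 <= #|[set (z ^+ 2 + z)%R | z : F]|)%N.
Proof.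
rewrite -(leq_pmul2l (m := 2)) // -expnS prednK // -hF.
pose f (z : F) := z ^+ 2 + z.
rewrite -[#|F|]sum1_card (partition_big f (mem [set f z | z : F])) /=; last first.
  by move=> z _; rewrite imset_f.
rewrite mulnC -sum_nat_const; apply: leq_sum => y /imsetP[z _ ->].
rewrite sum1dep_card; apply: (@leq_trans #|[set z; z + 1]|); last first.
  by rewrite cards2; case: eqP.
apply: subset_leq_card; apply/subsetP => w; rewrite !inE => /eqP.
by case/artin_schreier_fiber => ->; rewrite eqxx ?orbT.
Qed.

(* The left side is contained in the right side, and they have at least,
   respectively at most, half of the elements of F. *)
Lemma artin_schreier_image :
  [set z ^+ 2 + z | z : F] = [set x : F | Tr n x == 0].
Proof.
apply/eqP; rewrite eqEcard (leq_trans card_Tr_ker_le card_artin_schreier_ge).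
rewrite andbT; apply/subsetP => _ /imsetP[z _ ->].
by rewrite inE Tr_artin_schreier.
Qed.

Lemma card_Tr_ker : #|[set x : F | Tr n x == 0]| = (2 ^ n.-1)%N.
Proof.
apply/eqP; rewrite eqn_leq card_Tr_ker_le -artin_schreier_image.
exact: card_artin_schreier_ge.
Qed.

Lemma leaf_Tr (a : F) : a != 0 ->
  ((Some a : P1 F) \in leaves F) = (Tr n a^-1 != 0).
Proof.
have two0 : 2%:R = 0 :> F by exact: pcharf0.
move=> a0; rewrite inE; apply/forallP/idP => [leaf_a|Tr_neq0 [y|//]]; last first.
  rewrite /Gq /=; case: ifPn => // y0; apply/negP => /eqP[ya].
  (* From a = y + 1/y = (y + 1)^2 / y one gets 1/a = w^2 + w with w = 1/(y + 1). *)
  case/eqP: Tr_neq0; rewrite -(Tr_artin_schreier (y + 1)^-1).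
  have ysqr : (y + 1) ^+ 2 = a * y.
    by rewrite -ya mulrDl mulVf //; ring: two0.
  have y1 : y + 1 != 0.
    by have := mulf_neq0 a0 y0; rewrite -ysqr expf_eq0.
  (* Writing y as y + 2 = (y + 1) + 1 turns the identity into one that [field] proves in any
     characteristic. *)
  have -> : a^-1 = (y + 2%:R) / (y + 1) ^+ 2.
    by rewrite two0 addr0 ysqr invfM mulrCA mulfV ?mulr1.
  by congr (Tr n _); field.
apply/negP => Tr0.
have : a ^- 2 \in [set x : F | Tr n x == 0] by rewrite inE -exprVn Tr_sqr.
rewrite -artin_schreier_image => /imsetP[z _ az].
have z0 : z != 0.
  apply: contra_eq_neq az => ->.
  by rewrite expr0n addr0 invr_eq0 expf_neq0.
have /eqP[] := leaf_a (Some (a * z)).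
rewrite /= mulf_eq0 (negPf a0) (negPf z0) /=; congr Some.
(* The two preimages of a are a z and a (z + 1): their product is a^2 (z^2 + z) = 1 and their sum is
   a. *)
have -> : (a * z)^-1 = a * (z + 1).
  apply: (mulfI (mulf_neq0 a0 z0)); rewrite mulfV ?mulf_neq0 //.
  have -> : a * z * (a * (z + 1)) = a ^+ 2 * (z ^+ 2 + z) by ring.
  by rewrite -az mulfV // expf_neq0.
by ring: two0.
Qed.

(* If Tr x = 0 implied Tr x^-1 = 0, the 2^(n-1) - 1 nonzero x with Tr x = 0
   would be roots of P := Tr x / x + x^(2^(n-1)) * Tr x^-1. Its degree is too
   small, as the leading terms of the two summands cancel, and for n > 2 it is
   nonzero: the monomial x occurs in the first summand only. *)
Lemma exists_Tr0_TrV_neq0 : (2 < n)%N ->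
  exists x : F, [/\ x != 0, Tr n x = 0 & Tr n x^-1 != 0].
Proof.
move=> n_gt2.
suff /existsP[x /and3P[]] :
    [exists x : F, [&& x != 0, Tr n x == 0 & Tr n x^-1 != 0]].
  by move=> x0 /eqP Trx TrVx; exists x.
apply: contraT; rewrite negb_exists => /forallP noW.
have [m nE] : exists m, n = m.+3 by exists (n - 3)%N; lia.
(* Here [m.+2] is n - 1. The cancelling terms, the last one of Tr x / x and the first one of the
   other summand, are left out. *)
pose P : {poly F} :=
  \sum_(j < m.+2) 'X^(2 ^ j - 1) + \sum_(j < m.+2) 'X^(2 ^ m.+2 - 2 ^ j.+1).
have coef1_P : P`_1 = 1.
  rewrite coefD !coef_sum (bigD1 (Ordinal (isT : 1 < m.+2)%N)) //= coefXn eqxx.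
  rewrite !big1 ?addr0 // => j; last first.
    case: j => [] [|[|j]] lt_j // _; rewrite coefXn //= !expnS.
    have : (0 < 2 ^ j)%N by rewrite expn_gt0.
    by case: eqP => //; lia.
  by move=> _; rewrite coefXn !expnS -mulnBr; case: eqP => //; lia.
have P_neq0 : P != 0.
  by apply: contra_eq_neq coef1_P => ->; rewrite coef0 eq_sym oner_neq0.
have size_P : (size P <= 2 ^ m.+2 - 1)%N.
  have pow_pos k : (0 < 2 ^ k)%N by rewrite expn_gt0.
  apply: leq_trans (size_polyD _ _) _; rewrite geq_max; apply/andP; split;
    apply: leq_trans (size_sum _ _ _) _; apply/bigmax_leqP => j _;
    rewrite size_polyXn.
    have : (2 ^ j < 2 ^ m.+2)%N by rewrite ltn_exp2l.
    have := pow_pos j; lia.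
  have := pow_pos j; have := pow_pos m; rewrite !expnS; lia.
have card_roots : #|[set x : F | Tr n x == 0] :\ 0| = (2 ^ m.+2 - 1)%N.
  have := cardsD1 0 [set x : F | Tr n x == 0].
  rewrite card_Tr_ker inE nE /= => ->; rewrite (_ : Tr _ _ == 0).
    by rewrite addKn.
  by rewrite /Tr big1 // => j _; rewrite expr0n expn_eq0.
suff : (#|[set x : F | Tr n x == 0%R] :\ 0%R| < size P)%N.
  by rewrite card_roots ltnNge size_P.
rewrite cardE; apply: max_poly_roots => //; last exact: enum_uniq.
apply/allP => x; rewrite mem_enum !inE => /andP[x0 /eqP Trx].
have := noW x; rewrite x0 Trx eqxx /= negbK => /eqP.
rewrite nE /Tr big_ord_recl /= addrC => /eqP.
rewrite addr_eq0 oppr_pchar2 // => /eqP TrV.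
move: Trx; rewrite nE /Tr big_ord_recr /= => /eqP.
rewrite addr_eq0 oppr_pchar2 // => /eqP Trx.
(* After multiplication by x, both summands become x^(2^(n-1)), because the two traces vanish. *)
rewrite rootE hornerD !horner_sum -(mulrI_eq0 _ (mulfI x0)) mulrDr.
have -> : x * \sum_(j < m.+2) ('X^(2 ^ j - 1)).[x] = x ^+ (2 ^ m.+2).
  rewrite -Trx mulr_sumr.
  apply: eq_bigr => j _; rewrite hornerXn -exprS subn1 prednK //.
  by rewrite expn_gt0.
have -> : \sum_(j < m.+2) ('X^(2 ^ m.+2 - 2 ^ j.+1)).[x] =
          x ^+ (2 ^ m.+2) * \sum_(j < m.+2) x^-1 ^+ (2 ^ j.+1).
  rewrite mulr_sumr; apply: eq_bigr => j _; rewrite hornerXn exprVn.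
  by rewrite exprB ?unitfE // leq_exp2l.
by rewrite TrV mulrCA mulfV // mulr1 addrr_pchar2.
Qed.

End Trace.

End DicksonTrace.

Theorem lemma4p15 (n : nat) (F : finFieldType) (hn : 2 < n) (hF : #|F| = 2 ^ n) :
  L_B F n != set0 /\ T F (2 ^ n + 1) = L_B F n.
Proof.
have n_gt0 : 0 < n by apply: leq_trans hn.
split.
  have [x [x0 Trx TrVx]] := exists_Tr0_TrV_neq0 hF n_gt0 hn.
  apply/set0Pn; exists x; rewrite !inE x0 Trx eq_sym TrVx /=.
  by have := leaf_Tr hF n_gt0 x0; rewrite inE => ->.
apply/setP => a; rewrite addn1 [in LHS]inE [in RHS]inE [a \in B _ _]inE -andbA.
have [//|a0] := eqVneq a 0%R; have aV0 : (a^-1 != 0)%R by rewrite GRing.invr_eq0.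
rewrite (leaf_Tr hF n_gt0 a0) /= (dickson_root_card_succ hF a0).
rewrite (dickson_root_card_succ hF aV0) GRing.invrK negbK andbC.
(* If Tr(1/a) = 0, neither set contains a; otherwise Tr(1/a) = 1 and both conditions reduce to Tr(a)
   = 0. *)
have [_|TrV] := boolP (Tr n a^-1 == 0)%R; first by rewrite !andbF.
rewrite !andbT; move: TrV; rewrite -(Tr_eq1 hF) => /eqP ->.
by rewrite (Tr_eq1 hF) negbK.
Qed.
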